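(* Let $\lambda_1>\lambda_2>0$ and, for $\alpha\in(0,1)$, let $$\varrho(\alpha)=\max\left\{|1-2\alpha|,\ \left|1-2\alpha\left(1-\frac{\lambda_2}{\lambda_1}\right)\right|\right\}.$$ Then $\varrho$ is unimodal on the interval $(1/2,1)$. Moreover $\varrho(1/2)=\lambda_2/\lambda_1$ (the rate of the standard power method), while the asymptotically optimal step-size, i.e. the unique minimizer of $\varrho$ on $(1/2,1)$, is $$\alpha^*=\frac{1}{2-\lambda_2/\lambda_1}\in(1/2,1),$$ and it achieves $$\varrho(\alpha^* )=\frac{\lambda_2/\lambda_1}{2-\lambda_2/\lambda_1}<\frac{\lambda_2}{\lambda_1}.$$
   Context: Here $\lambda_1,\lambda_2$ are the two largest eigenvalues of a symmetric positive semidefinite matrix $\boldsymbol{A}$, and $\varrho(\alpha)$ is the asymptotic local linear rate of gradient descent with constant step-size $\alpha$ applied to $f(\boldsymbol{x})=\|\boldsymbol{x}\|^2-(\boldsymbol{x}^T\boldsymbol{A}\boldsymbol{x})^{1/2}$ (step-size $1/2$ corresponds to the power method up to scaling). A function on an interval is unimodal (for minimization) if it is strictly decreasing up to some interior point and strictly increasing after it. *)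

(* Defs.v *)
From mathcomp Require Import all_boot all_order all_algebra.

Set Implicit Arguments.
Unset Strict Implicit.
Unset Printing Implicit Defensive.

Import Order.TTheory GRing.Theory Num.Theory.
Local Open Scope ring_scope.

Definition rate (R : realFieldType) (lambda1 lambda2 alpha : R) : R :=
  Num.max `|1 - 2 * alpha| `|1 - 2 * alpha * (1 - lambda2 / lambda1)|.

(* Unimodality in the sense of minimization; the turning point belongs to
   both monotonicity intervals. *)
Definition unimodal_on (R : realFieldType) (a b : R) (f : R -> R) : Prop :=
  exists m : R,
    [/\ m \in `]a, b[,
        {in `]a, m] &, forall x y, x < y -> f y < f x}
      & {in `[m, b[ &, forall x y, x < y -> f x < f y}].

Definition minimizer_on (R : realFieldType) (I : interval R) (f : R -> R)
    (x : R) : Prop :=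
  x \in I /\ {in I, forall y, f x <= f y}.

(* Main.v *)
(** With r = lambda2 / lambda1 in (0, 1), for alpha >= 1/2 the rate is the
    maximum of the increasing line 2 alpha - 1 and the decreasing line
    1 - 2 alpha (1 - r), which cross at alpha = 1 / (2 - r): the other branch of
    the second absolute value, 2 alpha (1 - r) - 1, never exceeds 2 alpha - 1. *)

Require Import Defs.
From mathcomp Require Import all_boot all_order all_algebra.
From mathcomp Require Import ring lra.

Set Implicit Arguments.
Unset Strict Implicit.
Unset Printing Implicit Defensive.

Import Order.TTheory GRing.Theory Num.Theory.
Local Open Scope ring_scope.

(** Both monotonicity intervals contain [m], so every other point of the interval compares directly
    with [m] and has a strictly larger value. *)
Lemma turning_point_unique_minimizer (R : realFieldType) (a b m : R)
    (f : R -> R) :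
    m \in `]a, b[ ->
    {in `]a, m] &, forall x y, x < y -> f y < f x} ->
    {in `[m, b[ &, forall x y, x < y -> f x < f y} ->
  unique (minimizer_on `]a, b[ f) m.
Proof.
rewrite in_itv /= => /andP[am mb] fdec finc.
have fm_lt y : y \in `]a, b[ -> y != m -> f m < f y.
  rewrite in_itv /= => /andP[ay yb]; rewrite neq_lt => /orP[ym|my].
    by apply: fdec => //; rewrite in_itv /= ?ay ?am ?lexx ?ltW.
  by apply: finc => //; rewrite in_itv /= ?yb ?mb ?lexx ?ltW.
have mI : m \in `]a, b[ by rewrite in_itv /= am mb.
split=> [|y [yI ymin]].
  by split=> // y yI; have [->|/(fm_lt y yI)/ltW] := eqVneq y m.
apply/eqP; rewrite eq_sym; apply/negP => /negP /(fm_lt y yI).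
by rewrite ltNge ymin.
Qed.

Lemma rate_ge_half (R : realFieldType) (l1 l2 x : R) :
    0 <= l2 / l1 <= 1 -> 1 / 2 <= x ->
  rate l1 l2 x = Num.max (2 * x - 1) (1 - 2 * x * (1 - l2 / l1)).
Proof.
rewrite /rate; set r := l2 / l1 => /andP[r_ge0 r_le1] hx.
have -> : `|1 - 2 * x| = 2 * x - 1 by rewrite ler0_norm ?opprB //; lra.
have [?|lt0] := ger0P (1 - 2 * x * (1 - r)); first by [].
(* Here [2 * x - 1] dominates both sides: it is nonnegative, and it exceeds [2 * x * (1 - r) - 1] by
   [2 * x * r >= 0]. *)
by rewrite !max_l //; nra.
Qed.

(** With [r = l2 / l1], the upper bound on [x] reads [x * (2 - r) <= 1], which is half of
    [2 * x - 1 <= 1 - 2 * x * (1 - r)]. *)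
Lemma rate_left (R : realFieldType) (l1 l2 x : R) :
    0 <= l2 / l1 < 1 -> 1 / 2 <= x -> x <= 1 / (2 - l2 / l1) ->
  rate l1 l2 x = 1 - 2 * x * (1 - l2 / l1).
Proof.
move=> /andP[r_ge0 r_lt1] hx.
rewrite rate_ge_half ?r_ge0 ?(ltW r_lt1) // ler_pdivlMr; last by lra.
by move=> xm; rewrite max_r //; lra.
Qed.

Lemma rate_right (R : realFieldType) (l1 l2 x : R) :
    0 <= l2 / l1 < 1 -> 1 / 2 <= x -> 1 / (2 - l2 / l1) <= x ->
  rate l1 l2 x = 2 * x - 1.
Proof.
move=> /andP[r_ge0 r_lt1] hx.
rewrite rate_ge_half ?r_ge0 ?(ltW r_lt1) // ler_pdivrMr; last by lra.
by move=> mx; rewrite max_l //; lra.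
Qed.

Theorem corollary3p7 (R : realFieldType) (lambda1 lambda2 : R)
    (lambda2_gt0 : 0 < lambda2) (lambda21 : lambda2 < lambda1) :
  let rho := rate lambda1 lambda2 in
  let alpha_star := 1 / (2 - lambda2 / lambda1) in
  [/\ unimodal_on (1 / 2) 1 rho,
      rho (1 / 2) = lambda2 / lambda1,
      alpha_star \in `]1 / 2, 1[,
      unique (minimizer_on `]1 / 2, 1[ rho) alpha_star
    & rho alpha_star = (lambda2 / lambda1) / (2 - lambda2 / lambda1) /\
      (lambda2 / lambda1) / (2 - lambda2 / lambda1) < lambda2 / lambda1].
Proof.
move=> rho m.
have l1_gt0 : 0 < lambda1 := lt_trans lambda2_gt0 lambda21.
have r_gt0 : 0 < lambda2 / lambda1 by rewrite divr_gt0.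
have r_lt1 : lambda2 / lambda1 < 1 by rewrite ltr_pdivrMr // mul1r.
have r01 : 0 <= lambda2 / lambda1 < 1 by rewrite (ltW r_gt0) r_lt1.
have left_eq x := @rate_left R _ _ x r01.
have right_eq x := @rate_right R _ _ x r01.
rewrite -/rho -/m in left_eq right_eq.
set r := lambda2 / lambda1 in m r_gt0 r_lt1 r01 left_eq right_eq *.
have r2_gt0 : 0 < 2 - r by lra.
(* The lower bound amounts to [0 < r], the upper one to [r < 1]. *)
have m_gt : 1 / 2 < m by rewrite /m ltr_pdivlMr //; lra.
have m_lt : m < 1 by rewrite /m ltr_pdivrMr //; lra.
have mI : m \in `]1 / 2, 1[ by rewrite in_itv /= m_gt m_lt.
have rho_dec : {in `]1 / 2, m] &, forall x y, x < y -> rho y < rho x}.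
  move=> x y; rewrite !in_itv /= => /andP[hx xm] /andP[hy ym] xy.
  (* The slope [- 2 * (1 - r)] is negative since [r < 1]. *)
  by rewrite !left_eq ?(ltW hx) ?(ltW hy) //; nra.
have rho_inc : {in `[m, 1[ &, forall x y, x < y -> rho x < rho y}.
  move=> x y; rewrite !in_itv /= => /andP[mx _] /andP[my _] xy.
  by rewrite !right_eq ?(le_trans (ltW m_gt)) //; lra.
split=> //.
- by exists m.
- by rewrite left_eq ?lexx ?(ltW m_gt) //; lra.
- exact: turning_point_unique_minimizer.
(* The strict inequality reduces to [r < r * (2 - r)], that is, [0 < r * (1 - r)]. *)
- split; last by rewrite ltr_pdivrMr //; nra.
  rewrite right_eq ?lexx ?(ltW m_gt) // /m.
  by field; rewrite gt_eqF.
Qed.
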